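(* Let $(\mathcal{X},d)$ be a Polish metric space and let $(X_N)_{N\in\mathbb{N}}$ be a Markov chain on $\mathcal{X}$ with transition kernel $(P_x)_{x\in\mathcal{X}}$, where $x\mapsto P_x$ is measurable and each $P_x$ has finite first moment. Assume there exists $\kappa>0$ such that $W_1(P_x,P_y)\le(1-\kappa)\,d(x,y)$ for all $x,y\in\mathcal{X}$, and let $\pi$ be the invariant probability measure. Let $T\ge1$, $T_0\ge0$ be integers and $\hat\pi(f):=\frac1T\sum_{k=T_0+1}^{T_0+T}f(X_k)$. Assume there is a Lipschitz function $S:\mathcal{X}\to\mathbb{R}$ with $\|S\|_{\mathrm{Lip}}\le C$ such that $\frac{\sigma(x)^2}{n_x\kappa}\le S(x)$ for all $x\in\mathcal{X}$. Then for every Lipschitz $f$ and every $x\in\mathcal{X}$, \[ \operatorname{Var}_x\hat\pi(f)\le \begin{cases} \dfrac{\|f\|_{\mathrm{Lip}}^2}{\kappa T}\Big(\mathbb{E}_\pi S+\dfrac{C}{\kappa T}E(x)\Big), & \text{if } T_0=0,\\[2mm] \dfrac{\|f\|_{\mathrm{Lip}}^2}{\kappa T}\Big(\big(1+\dfrac{1}{\kappa T}\big)\mathbb{E}_\pi S+\dfrac{2C(1-\kappa)^{T_0}}{\kappa T}E(x)\Big), & \text{otherwise.} \end{cases} \]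
   Context: $W_1$ is the $L^1$ Wasserstein distance. $\operatorname{Var}_x$ is the variance for the chain started at $X_0=x$. $E(x):=\int d(x,y)\,\pi(dy)$ (eccentricity). $\sigma(x)^2:=\frac12\iint d(y,z)^2P_x(dy)P_x(dz)$; $n_x:=\inf\{\iint d(y,z)^2P_x(dy)P_x(dz)/\iint|f(y)-f(z)|^2P_x(dy)P_x(dz): f\ 1\text{-Lipschitz}\}$. $\|f\|_{\mathrm{Lip}}:=\sup_{x\ne y}|f(x)-f(y)|/d(x,y)$. *)

(* Defs.v *)
From HB Require Import structures.
From mathcomp Require Import all_boot all_order all_algebra.
From mathcomp Require Import all_classical all_reals all_analysis.
From mathcomp Require Import measurable_realfun.
Set Implicit Arguments. Unset Strict Implicit. Unset Printing Implicit Defensive.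
Import Order.TTheory GRing.Theory Num.Theory.
Local Open Scope classical_set_scope.
Local Open Scope ring_scope.

Definition is_metric (X : Type) (R : realType) (d : X -> X -> R) : Prop :=
  [/\ forall x y, d x y = 0 <-> x = y,
      forall x y, d x y = d y x &
      forall x y z, d x z <= d x y + d y z].

Definition d_cauchy (X : Type) (R : realType) (d : X -> X -> R) (u : nat -> X) :=
  forall e : R, 0 < e -> exists N, forall m n, (N <= m)%N -> (N <= n)%N -> d (u m) (u n) < e.

Definition d_converges (X : Type) (R : realType) (d : X -> X -> R) (u : nat -> X) (l : X) :=
  forall e : R, 0 < e -> exists N, forall n, (N <= n)%N -> d (u n) l < e.

Definition polish (X : Type) (R : realType) (d : X -> X -> R) : Prop :=
  [/\ is_metric d,
      (forall u, d_cauchy d u -> exists l, d_converges d u l) &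
      exists D : set X, countable D /\
        forall x (e : R), 0 < e -> exists2 y, D y & d x y < e].

Definition d_open (X : Type) (R : realType) (d : X -> X -> R) : set (set X) :=
  [set A | forall x, A x -> exists2 e : R, 0 < e & forall y, d x y < e -> A y].

Definition borel_of (dX : measure_display) (X : measurableType dX) (R : realType)
  (d : X -> X -> R) : Prop :=
  (@measurable _ X) = <<s d_open d >>.

(* ||f||_Lip = sup_{x <> y} |f x - f y| / d x y  (taken to be 0 when X has < 2 points) *)
Definition lipnorm (X : Type) (R : realType) (d : X -> X -> R) (f : X -> R) : \bar R :=
  ereal_sup ([set 0%E] `|`
    [set r | exists x y, x <> y /\ r = (`|f x - f y| / d x y)%:E]).

Definition one_lipschitz (X : Type) (R : realType) (d : X -> X -> R) (f : X -> R) :=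
  forall x y, `|f x - f y| <= d x y.

Definition is_coupling (dX : measure_display) (X : measurableType dX) (R : realType)
  (mu nu : probability X R) (g : probability (X * X)%type R) : Prop :=
  forall A : set X, measurable A ->
    g (A `*` setT) = mu A /\ g (setT `*` A) = nu A.

Definition W1 (dX : measure_display) (X : measurableType dX) (R : realType)
  (d : X -> X -> R) (mu nu : probability X R) : \bar R :=
  ereal_inf [set r | exists g : probability (X * X)%type R,
      is_coupling mu nu g /\ r = (\int[g]_p (d p.1 p.2)%:E)%E].

Definition kernel_measurable (dX : measure_display) (X : measurableType dX) (R : realType)
  (P : X -> probability X R) : Prop :=
  forall A : set X, measurable A -> measurable_fun [set: X] ((fun x => P x A) : X -> \bar R).

Definition finite_first_moment (dX : measure_display) (X : measurableType dX) (R : realType)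
  (d : X -> X -> R) (mu : probability X R) : Prop :=
  exists x0 : X, (\int[mu]_y (d x0 y)%:E < +oo)%E.

Definition is_invariant (dX : measure_display) (X : measurableType dX) (R : realType)
  (P : X -> probability X R) (pi : probability X R) : Prop :=
  forall A : set X, measurable A -> pi A = (\int[pi]_x P x A)%E.

Definition markov_chain (dO : measure_display) (Omega : measurableType dO)
  (dX : measure_display) (X : measurableType dX) (R : realType)
  (Pr : probability Omega R) (Xs : nat -> Omega -> X)
  (P : X -> probability X R) (x : X) : Prop :=
  [/\ forall n, measurable_fun setT (Xs n),
      forall A : set X, measurable A -> Pr (Xs 0%N @^-1` A) = \d_x A &
      forall (k : nat) (A : nat -> set X), (forall i, measurable (A i)) ->
        Pr (\bigcap_(i in `I_k.+2) (Xs i @^-1` A i)) =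
        (\int[Pr]_(w in \bigcap_(i in `I_k.+1) (Xs i @^-1` A i)) P (Xs k w) (A k.+1))%E].

Definition sigma2 (dX : measure_display) (X : measurableType dX) (R : realType)
  (d : X -> X -> R) (P : X -> probability X R) (x : X) : \bar R :=
  ((2^-1)%:E * \int[P x]_y \int[P x]_z (d y z ^+ 2)%:E)%E.

(* n_x = inf over 1-Lipschitz f of iint d^2 / iint |f(y)-f(z)|^2
   (only f with nonzero denominator are considered; inf of empty set = +oo) *)
Definition nx (dX : measure_display) (X : measurableType dX) (R : realType)
  (d : X -> X -> R) (P : X -> probability X R) (x : X) : \bar R :=
  ereal_inf [set r | exists f : X -> R, one_lipschitz d f /\
     (0 < \int[P x]_y \int[P x]_z (`|f y - f z| ^+ 2)%:E)%E /\
     r = ((\int[P x]_y \int[P x]_z (d y z ^+ 2)%:E) *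
          (\int[P x]_y \int[P x]_z (`|f y - f z| ^+ 2)%:E)^-1)%E].

Definition eccentricity (dX : measure_display) (X : measurableType dX) (R : realType)
  (d : X -> X -> R) (pi : probability X R) (x : X) : \bar R :=
  (\int[pi]_y (d x y)%:E)%E.

Definition pihat (dO : measure_display) (Omega : measurableType dO)
  (dX : measure_display) (X : measurableType dX) (R : realType)
  (Xs : nat -> Omega -> X) (T T0 : nat) (f : X -> R) : Omega -> R :=
  fun w => (T%:R)^-1 * \sum_(T0.+1 <= k < T0 + T + 1) f (Xs k w).

(* Main.v *)
Require Import Defs.
From HB Require Import structures.
From mathcomp Require Import finmap.
From mathcomp Require Import all_boot all_order all_algebra.
From mathcomp Require Import all_classical all_reals all_analysis.
From mathcomp Require Import measurable_realfun.
From mathcomp Require Import ring lra.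
(** The sum [\sum_k u_k (X_k)] is peeled off from its last term: with [Pf] the
    mean of [f] under the kernel, [u_(m+1) (X_(m+1))] is [P u_(m+1) (X_m)] plus
    an innovation uncorrelated with every [h (X_i)], [i <= m].  The innovation
    has variance at most [K^2 kappa E S(X_m)] when [u_(m+1)] is [K]-Lipschitz,
    because [Var_(P_y) g <= sigma(y)^2 / n_y] for a 1-Lipschitz [g], and
    [P u_(m+1)] is [K (1 - kappa)]-Lipschitz by the easy half of
    Kantorovich-Rubinstein, so it can be absorbed in [u_m].  Iterating gives
    [Var <= kappa \sum_j a_(j+1)^2 E S(X_j)] where [a_k] bounds the Lipschitz
    constant of the function accumulated at time [k].  Finally
    [E S(X_j) <= E_pi S + C (1 - kappa)^j E(x)] by the invariance of [pi], and
    the weights form geometric sums. *)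

Set Implicit Arguments.
Unset Strict Implicit.
Unset Printing Implicit Defensive.
Import Order.TTheory GRing.Theory Num.Theory.
Local Open Scope classical_set_scope.
Local Open Scope ring_scope.

(** * Induction over nonnegative measurable functions *)

Section ge0_measurable_induction.
Context {d} {T : measurableType d} {R : realType}.
Local Open Scope ereal_scope.
Import HBNNSimple.

(** Simple functions increase to [f] and are finite combinations of indicators. The linear step has
    the form [k * f + g] so that a simple function is built one value at a time, along the list of
    its range. *)
Lemma ge0_measurable_ind (Q : (T -> \bar R) -> Prop) :
  (forall A, measurable A -> Q (fun x => (\1_A x)%:E)) ->
  (forall (k : R) f g, (0 <= k)%R ->
     (forall x, 0 <= f x) -> measurable_fun setT f -> Q f ->
     (forall x, 0 <= g x) -> measurable_fun setT g -> Q g ->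
     Q (fun x => k%:E * f x + g x)) ->
  (forall u : nat -> T -> \bar R, (forall n x, 0 <= u n x) ->
     (forall n, measurable_fun setT (u n)) ->
     (forall x, {homo u ^~ x : m n / (m <= n)%N >-> m <= n}) ->
     (forall n, Q (u n)) -> Q (fun x => limn (u ^~ x))) ->
  forall f, (forall x, 0 <= f x) -> measurable_fun setT f -> Q f.
Proof.
move=> Q1 QD Qlim f f0 mf.
pose u n : T -> \bar R := EFin \o nnsfun_approx measurableT mf n.
have -> : f = (fun x => limn (u ^~ x)).
  by apply/funext => x; apply/esym/cvg_lim => //; exact: cvg_nnsfun_approx.
have mu n : measurable_fun setT (u n) by exact/measurable_EFinP.
apply: Qlim => //.
- by move=> n x; rewrite lee_fin.
- by move=> x m n mn; rewrite lee_fin; exact/lefP/nd_nnsfun_approx.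
move=> n; rewrite /u; set h := nnsfun_approx _ _ _.
pose s : seq R := finmap.enum_fset (fset_set (range h)).
have -> : EFin \o h = (fun x => \sum_(y <- s)
    y%:E * (\1_(h @^-1` [set y]) x)%:E).
  apply/funext => x /=; rewrite fimfunE fsbig_finite//= -sumEFin.
  by apply: eq_bigr => y _; rewrite EFinM.
have : {in s, forall y, (0 <= y)%R}.
  move=> y ys; have : y \in fset_set (range h) by [].
  by rewrite in_fset_set// => /set_mem[x _ <-].
elim: s => [|y s ih] s0.
  rewrite (_ : (fun _ => _) = fun x => (\1_(set0 : set T) x)%:E); first exact: Q1.
  by apply/funext => x; rewrite big_nil indicE in_set0.
rewrite (_ : (fun _ => _) = fun x => y%:E * (\1_(h @^-1` [set y]) x)%:E +
   \sum_(y <- s) y%:E * (\1_(h @^-1` [set y]) x)%:E); last first.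
  by apply/funext => x; rewrite big_cons.
have s0' : {in s, forall y, (0 <= y)%R}.
  by move=> z zs; apply: s0; rewrite inE zs orbT.
have mh z : measurable (h @^-1` [set z]) by exact: measurable_sfunP.
apply: (QD y (fun x => (\1_(h @^-1` [set y]) x)%:E)) => //.
- by apply: s0; rewrite inE eqxx.
- exact/measurable_EFinP.
- exact: Q1.
- by move=> x; rewrite big_seq sume_ge0// => z zs; rewrite mule_ge0// lee_fin// s0'.
- by apply: emeasurable_sum => z; apply: measurable_funeM; exact/measurable_EFinP.
- exact: ih.
Qed.

End ge0_measurable_induction.

(** * Integration against mixtures of kernels *)

Section ge0_integral_kernel.
Context {d d'} {T : measurableType d} {X : measurableType d'} {R : realType}.
Variables (mu : {measure set T -> \bar R}) (K : T -> {measure set X -> \bar R}).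
Local Open Scope ereal_scope.
Hypothesis mK : forall A, measurable A -> measurable_fun setT (K ^~ A).

Lemma ge0_integral_kernelD (k : R) (f g : X -> \bar R) : (0 <= k)%R ->
  (forall x, 0 <= f x) -> measurable_fun setT f ->
  (forall x, 0 <= g x) -> measurable_fun setT g ->
  \int[mu]_w \int[K w]_x (k%:E * f x + g x) =
  k%:E * \int[mu]_w \int[K w]_x f x + \int[mu]_w \int[K w]_x g x.
Proof.
move=> k0 f0 mf g0 mg.
have mKI h (h0 : forall x, 0 <= h x) (mh : measurable_fun setT h) :
  measurable_fun setT (fun w => \int[K w]_x h x).
  exact: measurable_fun_integral_kernel.
have kf0 x : setT x -> 0 <= k%:E * f x by move=> _; rewrite mule_ge0.
have mkf : measurable_fun setT (fun x => k%:E * f x) by exact: measurable_funeM.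
under eq_integral do rewrite ge0_integralD// ge0_integralZl//.
rewrite ge0_integralD//; last 4 first.
- by move=> w _; rewrite mule_ge0// integral_ge0.
- by apply: measurable_funeM; exact: mKI.
- by move=> w _; rewrite integral_ge0.
- exact: mKI.
rewrite ge0_integralZl//.
- exact: mKI.
- by move=> w _; rewrite integral_ge0.
Qed.

Lemma ge0_integral_kernel_lim (u : nat -> X -> \bar R) :
  (forall n x, 0 <= u n x) -> (forall n, measurable_fun setT (u n)) ->
  (forall x, {homo u ^~ x : m n / (m <= n)%N >-> m <= n}) ->
  \int[mu]_w \int[K w]_x limn (u ^~ x) =
  limn (fun n => \int[mu]_w \int[K w]_x u n x).
Proof.
move=> u0 mu' ndu.
under eq_integral.
  by move=> w _; rewrite monotone_convergence//; over.
rewrite monotone_convergence//.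
- by move=> n; exact: measurable_fun_integral_kernel.
- by move=> n w _; rewrite integral_ge0.
- by move=> w _ m n mn; apply: ge0_le_integral => // x _; exact: ndu.
Qed.

End ge0_integral_kernel.

(** Indicators, then linearity, then monotone limits. With Dirac kernels on one or both sides it
    gives the change of variables, the one-step transition of the chain and the use of
    invariance. *)
Lemma ge0_integral_kernel_eq {d1 d2 d'} {T1 : measurableType d1}
    {T2 : measurableType d2} {X : measurableType d'} {R : realType}
    (mu1 : {measure set T1 -> \bar R}) (mu2 : {measure set T2 -> \bar R})
    (K1 : T1 -> {measure set X -> \bar R}) (K2 : T2 -> {measure set X -> \bar R}) :
  (forall A, measurable A -> measurable_fun setT (K1 ^~ A)) ->
  (forall A, measurable A -> measurable_fun setT (K2 ^~ A)) ->
  (forall A, measurable A -> \int[mu1]_w K1 w A = \int[mu2]_w K2 w A)%E ->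
  forall g : X -> \bar R, (forall x, 0 <= g x)%E -> measurable_fun setT g ->
  (\int[mu1]_w \int[K1 w]_x g x = \int[mu2]_w \int[K2 w]_x g x)%E.
Proof.
move=> mK1 mK2 K12; apply: ge0_measurable_ind.
- move=> A mA; have := K12 A mA.
  rewrite -(setIT A); under eq_integral do rewrite -integral_indic//.
  by under [X in _ = X -> _]eq_integral do rewrite -integral_indic//; rewrite setIT.
- move=> k f g k0 f0 mf Qf g0 mg Qg.
  by rewrite !ge0_integral_kernelD// Qf Qg.
- move=> u u0 mu' ndu Qu; rewrite !ge0_integral_kernel_lim//.
  by apply: congr_lim; apply/funext => n; exact: Qu.
Qed.

(** * Equality of conditional means, tested on functions *)

Section ge0_integral_extension.
Context {d d'} {T : measurableType d} {X : measurableType d'} {R : realType}.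
Local Open Scope ereal_scope.

(** [G] and [H] have the same conditional mean given [Y]; induction on [h] passes from events of [Y]
    to functions of [Y]. It serves to multiply the Markov property by a function of the past. *)
Lemma ge0_integral_comp_mul (mu : {measure set T -> \bar R}) (Y : T -> X)
    (G H : T -> R) :
  measurable_fun setT Y ->
  (forall w, 0 <= G w)%R -> measurable_fun setT G ->
  (forall w, 0 <= H w)%R -> measurable_fun setT H ->
  (forall A, measurable A -> \int[mu]_(w in Y @^-1` A) (G w)%:E =
     \int[mu]_(w in Y @^-1` A) (H w)%:E) ->
  forall h, (forall x, 0 <= h x) -> measurable_fun setT h ->
  \int[mu]_w (h (Y w) * (G w)%:E) = \int[mu]_w (h (Y w) * (H w)%:E).
Proof.
move=> mY G0 mG H0 mH GH.
have mhY (h : X -> \bar R) : measurable_fun setT h -> measurable_fun setT (h \o Y).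
  by move=> mh; exact: measurableT_comp.
have restr F A : \int[mu]_(w in Y @^-1` A) (F w)%:E =
    \int[mu]_w ((\1_A (Y w))%:E * (F w)%:E).
  rewrite integral_mkcond epatch_indic; apply: eq_integral => w _ /=.
  by rewrite muleC !indicE; congr (_%:R%:E * _); apply/idP/idP; rewrite !inE.
apply: ge0_measurable_ind.
- by move=> A mA; rewrite -!restr GH.
- move=> k f g k0 f0 mf Qf g0 mg Qg.
  have splitE (F : T -> R) (F0 : forall w, (0 <= F w)%R) (mF : measurable_fun setT F) :
      \int[mu]_w ((k%:E * f (Y w) + g (Y w)) * (F w)%:E) =
      k%:E * \int[mu]_w (f (Y w) * (F w)%:E) + \int[mu]_w (g (Y w) * (F w)%:E).
    have mfF : measurable_fun setT (fun w => f (Y w) * (F w)%:E).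
      by apply: emeasurable_funM; [exact: mhY|exact/measurable_EFinP].
    have mgF : measurable_fun setT (fun w => g (Y w) * (F w)%:E).
      by apply: emeasurable_funM; [exact: mhY|exact/measurable_EFinP].
    rewrite -ge0_integralZl//; last by move=> w _; rewrite mule_ge0// lee_fin.
    rewrite -ge0_integralD//.
    + apply: eq_integral => w _; rewrite muleA ge0_muleDl// mule_ge0//.
    + by move=> w _; rewrite !mule_ge0// lee_fin.
    + exact: measurable_funeM.
    + by move=> w _; rewrite mule_ge0// lee_fin.
  by rewrite !splitE// Qf Qg.
- move=> u u0 mu' ndu Qu.
  have lims (F : T -> R) (F0 : forall w, (0 <= F w)%R) (mF : measurable_fun setT F) :
      \int[mu]_w (limn (u ^~ (Y w)) * (F w)%:E) =
      limn (fun n => \int[mu]_w (u n (Y w) * (F w)%:E)).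
    rewrite -monotone_convergence//.
    + apply: eq_integral => w _; rewrite limeMr//.
      by apply: ereal_nondecreasing_is_cvgn; exact: ndu.
    + by move=> n; apply: emeasurable_funM => //; [exact: mhY|exact/measurable_EFinP].
    + by move=> n w _; rewrite mule_ge0// lee_fin.
    + by move=> w _ m n mn; rewrite lee_wpmul2r// ?lee_fin// ndu.
  by rewrite !lims//; apply: congr_lim; apply/funext => n; exact: Qu.
Qed.

End ge0_integral_extension.

(** * Monotonicity, square integrability and change of variables *)

Section integral_complements.
Context {d} {T : measurableType d} {R : realType}.
Local Open Scope ereal_scope.
Import HBNNSimple.

(* Unlike [ge0_le_integral], no measurability is needed: the integral of a
   nonnegative function is a supremum over the simple functions below it. *)
Lemma ge0_le_integral_nonmeasurable (mu : {measure set T -> \bar R}) (f g : T -> \bar R) :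
  (forall x, 0 <= f x) -> (forall x, f x <= g x) ->
  \int[mu]_x f x <= \int[mu]_x g x.
Proof.
move=> f0 fg; have g0 x : 0 <= g x by exact: le_trans (fg x).
rewrite !ge0_integralTE//; apply: ereal_sup_le => _ [h hf <-].
by exists h => // x; apply: le_trans (fg x); exact: hf.
Qed.

Lemma sqr_integrable_Lfun2 (mu : {measure set T -> \bar R}) (f : T -> R) :
  measurable_fun setT f -> \int[mu]_x (f x ^+ 2)%:E < +oo -> f \in Lfun mu 2%:E.
Proof.
move=> mf f2; rewrite inE; apply/andP; split; first by rewrite inE.
rewrite inE/= /finite_norm unlock/= poweR_lty//.
apply: le_lt_trans f2; apply: ge0_le_integral => //.
- apply/measurable_EFinP; apply: (measurableT_comp (measurable_powR _)) => //.
  exact: measurableT_comp.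
- exact/measurable_EFinP/measurable_funX.
- by move=> x _; rewrite lee_fin/= powR_mulrn// -normrX ger0_norm// sqr_ge0.
Qed.

(** Both sides are mixtures of Dirac masses, at [Y w] under [mu] and at [x] under [nu]. Agreement on
    measurable sets is exactly what couplings and the initial law of the chain provide. *)
Lemma ge0_law_integral {d'} {X : measurableType d'} (mu : {measure set T -> \bar R})
    (nu : {measure set X -> \bar R}) (Y : T -> X) (f : X -> \bar R) :
  measurable_fun setT Y -> (forall A, measurable A -> nu A = mu (Y @^-1` A)) ->
  (forall x, 0 <= f x) -> measurable_fun setT f ->
  \int[mu]_w f (Y w) = \int[nu]_x f x.
Proof.
move=> mY nuE f0 mf.
have mdirac A : measurable A -> measurable_fun setT (fun w => \d_(Y w) A : \bar R).
  by move=> mA; exact: (measurableT_comp (measurable_fun_dirac mA)).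
have mdirac' (A : set X) : measurable A -> measurable_fun setT (fun x : X => \d_x A : \bar R).
  by move=> mA; exact: measurable_fun_dirac.
have := @ge0_integral_kernel_eq _ _ _ _ _ _ _ mu nu (fun w => \d_(Y w)) (fun x => \d_x).
move=> /(_ mdirac mdirac') h.
transitivity (\int[mu]_w \int[\d_(Y w)]_x f x).
  by apply: eq_integral => w _; rewrite integral_dirac// diracT mul1e.
rewrite h//; first by apply: eq_integral => w _; rewrite integral_dirac// diracT mul1e.
move=> A mA.
have mYA : measurable (Y @^-1` A) by rewrite -[X in measurable X]setTI; exact: mY.
transitivity (\int[mu]_w (\1_(Y @^-1` A) w)%:E).
  apply: eq_integral => w _; rewrite /= diracE indicE.
  suff -> : (w \in Y @^-1` A) = (Y w \in A) by [].
  by apply/idP/idP; rewrite !inE.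
transitivity (\int[nu]_x (\1_A x)%:E); last first.
  by apply: eq_integral => x _; rewrite /= diracE indicE.
by rewrite !integral_indic// !setIT nuE.
Qed.

Lemma law_integral {d'} {X : measurableType d'} (mu : {measure set T -> \bar R})
    (nu : {measure set X -> \bar R}) (Y : T -> X) (f : X -> \bar R) :
  measurable_fun setT Y -> (forall A, measurable A -> nu A = mu (Y @^-1` A)) ->
  measurable_fun setT f -> \int[mu]_w f (Y w) = \int[nu]_x f x.
Proof.
move=> mY nuE mf; rewrite integralE [RHS]integralE; congr (_ - _).
  rewrite -(ge0_law_integral mY nuE (f := f^\+))//; last exact: measurable_funepos.
  by apply: eq_integral => w _; exact: (congr1 (fun h => h w) (funepos_comp f Y)).
rewrite -(ge0_law_integral mY nuE (f := f^\-))//; last exact: measurable_funeneg.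
by apply: eq_integral => w _; exact: (congr1 (fun h => h w) (funeneg_comp f Y)).
Qed.

Lemma law_integrable {d'} {X : measurableType d'} (mu : {measure set T -> \bar R})
    (nu : {measure set X -> \bar R}) (Y : T -> X) (f : X -> \bar R) :
  measurable_fun setT Y -> (forall A, measurable A -> nu A = mu (Y @^-1` A)) ->
  nu.-integrable setT f -> mu.-integrable setT (f \o Y).
Proof.
move=> mY nuE /integrableP[mf fy]; apply/integrableP; split.
  exact: measurableT_comp.
by rewrite (ge0_law_integral mY nuE (f := fun x => `|f x|))//; exact: measurableT_comp.
Qed.

End integral_complements.

(** * Lipschitz functions and the easy half of Kantorovich duality *)

Section lipschitz.
Context {dX} {X : measurableType dX} {R : realType} (d : X -> X -> R).
Hypothesis dP : polish d.
Hypothesis dB : borel_of d.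

(** A real, not necessarily optimal constant in place of the extended [lipnorm], so that constants
    can be added, scaled and enlarged. *)
Definition lip (K : R) (f : X -> R) := forall x y, `|f x - f y| <= K * d x y.

Let dxx x : d x x = 0. Proof. by case: dP => -[d0 _ _] _ _; apply/d0. Qed.
Lemma metricC x y : d x y = d y x. Proof. by case: dP => -[_ + _]. Qed.
Lemma metric_triangle x y z : d x z <= d x y + d y z.
Proof. by case: dP => -[_ _ +]. Qed.
Lemma metric_ge0 x y : 0 <= d x y.
Proof. by have := metric_triangle x y x; rewrite dxx (metricC y x); lra. Qed.
Lemma metric_gt0 x y : x <> y -> 0 < d x y.
Proof.
move=> xy; rewrite lt_neqAle metric_ge0 andbT eq_sym; apply/eqP => d0.
by apply: xy; case: dP => -[h _ _] _ _; apply/h.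
Qed.

Lemma lipnorm_le_lip (K : R) f : (lipnorm d f <= K%:E)%E -> lip K f.
Proof.
move=> fK x y; have [->|xy] := pselect (x = y).
  by rewrite subrr normr0 dxx mulr0.
rewrite -ler_pdivrMr ?metric_gt0// -lee_fin; apply: le_trans fK.
by apply: ereal_sup_ubound; right; exists x, y.
Qed.

Lemma lipnorm_ge0 f : (0 <= lipnorm d f)%E.
Proof. by apply: ereal_sup_ubound; left. Qed.

Lemma lipS K L f : K <= L -> lip K f -> lip L f.
Proof. by move=> KL fK x y; apply: (le_trans (fK x y)); rewrite ler_wpM2r// metric_ge0. Qed.

Lemma lipD K L f g : lip K f -> lip L g -> lip (K + L) (f \+ g).
Proof.
move=> fK gL x y /=; have := fK x y; have := gL x y.
rewrite mulrDl (_ : f x + g x - _ = (f x - f y) + (g x - g y)); last by ring.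
by move=> h1 h2; apply: (le_trans (ler_normD _ _)); lra.
Qed.

Lemma lipZ K f a : lip K f -> lip (`|a| * K) (fun x => a * f x).
Proof. by move=> fK x y; rewrite -mulrBr normrM -mulrA ler_wpM2l. Qed.

Lemma lip_cst c : lip 0 (fun=> c).
Proof. by move=> x y; rewrite subrr normr0 mul0r. Qed.

Lemma lip_metric x : lip 1 (d x).
Proof.
move=> y z; rewrite mul1r ler_norml; apply/andP; split.
  by have := metric_triangle x y z; lra.
by have := metric_triangle x z y; rewrite (metricC z y); lra.
Qed.

Lemma lip_funrpos K f : lip K f -> lip K (f^\+)%R.
Proof.
move=> fK x y; apply: le_trans (fK x y); rewrite /funrpos.
by rewrite ler_norml; case: (leP (f x) 0); case: (leP (f y) 0) => h1 h2;
  have := ler_norm (f x - f y); have := ler_norm (f y - f x);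
  rewrite (distrC (f y)); lra.
Qed.

Lemma lip_funrneg K f : lip K f -> lip K (f^\-)%R.
Proof.
move=> fK x y; apply: le_trans (fK x y); rewrite /funrneg.
by rewrite ler_norml; case: (leP (- f x) 0); case: (leP (- f y) 0) => h1 h2;
  have := ler_norm (f x - f y); have := ler_norm (f y - f x);
  rewrite (distrC (f y)); lra.
Qed.

(** The sets where [f] exceeds [a] are open, and open sets generate the sigma-algebra. *)
Lemma lip_measurable K f : lip K f -> measurable_fun setT f.
Proof.
move=> fK.
apply: (measurability (@RGenOInfty.G R)); first exact: RGenOInfty.measurableE.
move=> _ [_ [a ->] <-]; rewrite setTI dB.
apply: sub_sigma_algebra => x /=; rewrite in_itv/= andbT => ax.
have K1 : 0 < `|K| + 1 by rewrite ltr_wpDl.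
(* Adding 1 keeps the denominator positive when [K = 0]. *)
exists ((f x - a) / (`|K| + 1)); first by rewrite divr_gt0 ?subr_gt0.
move=> y; rewrite ltr_pdivlMr// => xy; rewrite in_itv/= andbT.
have h1 := fK x y; have h2 := ler_norm (f x - f y).
have h3 : K * d x y <= d x y * (`|K| + 1).
  by rewrite mulrC ler_wpM2l ?metric_ge0//; have := ler_norm K; lra.
lra.
Qed.

Lemma lip_integrable K f (mu : probability X R) :
  finite_first_moment d mu -> lip K f -> mu.-integrable setT (EFin \o f).
Proof.
move=> [x0 dx0] fK.
have id0 : mu.-integrable setT (EFin \o d x0).
  apply/integrableP; split.
    exact/measurable_EFinP/(lip_measurable (lip_metric x0)).
  by under eq_integral do rewrite /= ger0_norm ?metric_ge0//.
apply: (@le_integrable _ _ _ mu _ measurableT _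
  (EFin \o (fun y => `|f x0| + K * d x0 y))) => //.
- exact/measurable_EFinP/(lip_measurable fK).
- move=> y _; rewrite /= lee_fin; apply: le_trans (ler_norm _).
  have := fK x0 y; have := ler_normB (f x0) (f x0 - f y).
  rewrite opprB addrC subrK; lra.
- rewrite (_ : _ \o _ = (EFin \o cst `|f x0|) \+ (fun y => K%:E * (d x0 y)%:E)%E)//.
  apply: integrableD => //.
    exact: finite_measure_integrable_cst.
  exact: integrableZl.
Qed.

Lemma W1_ge0 (mu nu : probability X R) : (0 <= W1 d mu nu)%E.
Proof.
apply: le_ereal_inf_tmp => _ [g [_ ->]].
by apply: integral_ge0 => p _; rewrite lee_fin metric_ge0.
Qed.

(** For any coupling the difference of the means is the integral of [f p.1 - f p.2], at most the
    transport cost in absolute value; the infimum over couplings concludes. *)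
Lemma kantorovich_le (mu nu : probability X R) f :
  finite_first_moment d mu -> finite_first_moment d nu -> lip 1 f ->
  (`|\int[mu]_x f x - \int[nu]_x f x|%:E <= W1 d mu nu)%E.
Proof.
move=> Fmu Fnu f1; have mf := lip_measurable f1.
have imu := lip_integrable Fmu f1; have inu := lip_integrable Fnu f1.
apply: le_ereal_inf_tmp => _ [g [cg ->]].
have mfst : measurable_fun setT (fst : X * X -> X) by exact: measurable_fst.
have msnd : measurable_fun setT (snd : X * X -> X) by exact: measurable_snd.
have lawfst A : measurable A -> mu A = g (fst @^-1` A).
  by move=> mA; have [<- _] := cg A mA; congr (g _); apply/seteqP; split => [[]|[]]//= ? ? [].
have lawsnd A : measurable A -> nu A = g (snd @^-1` A).
  by move=> mA; have [_ <-] := cg A mA; congr (g _); apply/seteqP; split => [[]|[]]//= ? ? [].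
have mEf : measurable_fun setT (EFin \o f) by exact/measurable_EFinP.
have i1 := law_integrable mfst lawfst imu.
have i2 := law_integrable msnd lawsnd inu.
have mf1 : measurable_fun setT (fun p : X * X => f p.1) by exact: (measurableT_comp mf mfst).
have mf2 : measurable_fun setT (fun p : X * X => f p.2) by exact: (measurableT_comp mf msnd).
rewrite /Rintegral -[X in fine X - _](law_integral mfst lawfst mEf).
rewrite -[X in _ - fine X](law_integral msnd lawsnd mEf).
rewrite -/(Rintegral g setT (f \o fst)) -/(Rintegral g setT (f \o snd)).
rewrite -RintegralB// EFin_normr_Rintegral//; last first.
  exact: (integrableB measurableT i1 i2).
apply: (le_trans (le_abse_integral _ _ _)) => //.
  exact/measurable_EFinP/measurable_funB.
(* Measurability of the cost on the product is left open, hence the comparison valid for arbitrary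
   nonnegative functions. *)
apply: ge0_le_integral_nonmeasurable => // p /=.
by rewrite lee_fin; have := f1 p.1 p.2; rewrite mul1r.
Qed.

End lipschitz.

(** * The Markov operator and its contraction property *)

Section markov_operator.
Context {dX} {X : measurableType dX} {R : realType} (d : X -> X -> R).
Hypothesis dP : polish d.
Hypothesis dB : borel_of d.
Variables (P : X -> probability X R) (kappa : R).
Hypothesis PF : forall y, finite_first_moment d (P y).
Hypothesis W1P : forall y z, (W1 d (P y) (P z) <= ((1 - kappa) * d y z)%:E)%E.

(** Real-valued, so that it acts on Lipschitz functions and can be iterated; for these, [markov_opK]
    identifies it with the extended integral. *)
Definition markov_op (f : X -> R) (y : X) : R := \int[P y]_z f z.
Local Notation Pf := markov_op.

Lemma markov_op_ge0 f y : (forall z, 0 <= f z) -> 0 <= Pf f y.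
Proof. by move=> f0; apply: Rintegral_ge0 => z _. Qed.

Lemma markov_opK K f y : lip d K f -> ((Pf f y)%:E = \int[P y]_z (f z)%:E)%E.
Proof.
by move=> fK; rewrite fineK// integrable_fin_num//; exact: (lip_integrable dP dB (PF y) fK).
Qed.

Lemma markov_opB K L f g y : lip d K f -> lip d L g -> Pf (f \- g) y = Pf f y - Pf g y.
Proof.
move=> fK gL; rewrite /markov_op RintegralB//.
  exact: (lip_integrable dP dB (PF y) fK).
exact: (lip_integrable dP dB (PF y) gL).
Qed.

(** Rescaled to constant 1, [f] falls under [kantorovich_le], and the contraction of [W1] gives the
    factor [1 - kappa]. For [K = 0] rescaling is impossible, but [f] is constant. *)
Lemma markov_op_lip K f : 0 <= K -> lip d K f -> lip d (K * (1 - kappa)) (Pf f).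
Proof.
rewrite le_eqVlt => /predU1P[<- f0 y z|K0 fK y z].
  have -> : f = cst (f y).
    by apply/funext => t; apply/eqP; rewrite -subr_eq0 -normr_le0 (le_trans (f0 _ _))// mul0r.
  rewrite mul0r mul0r normr_le0 subr_eq0 /markov_op !Rintegral_cst//.
  apply/eqP; congr (_ * fine _).
  exact: eq_trans (probability_setT (P y)) (esym (probability_setT (P z))).
have f1 : lip d 1 (fun x => K^-1 * f x).
  by have := lipZ K^-1 fK; rewrite gtr0_norm ?invr_gt0// mulVf// gt_eqF.
have := le_trans (kantorovich_le dP dB (PF y) (PF z) f1) (W1P y z).
rewrite lee_fin !RintegralZl//; try exact: (lip_integrable dP dB (PF _) fK).
by rewrite -mulrBr normrM gtr0_norm ?invr_gt0// mulrC ler_pdivrMr// (mulrC _ K) mulrA.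
Qed.

(** Since [W1] is nonnegative, contraction at two distinct points forces [1 - kappa >= 0]. On a
    one-point space [kappa] may exceed 1. *)
Lemma kappa_le1 (y z : X) : y <> z -> kappa <= 1.
Proof.
move=> yz; have := le_trans (W1_ge0 dP (P y) (P z)) (W1P y z).
by rewrite lee_fin pmulr_lge0 ?subr_ge0//; exact: metric_gt0.
Qed.

(** * Variance of a Lipschitz function under one step *)

Section local_variance.
Variable S : X -> R.
Hypothesis kappa0 : 0 < kappa.
Hypothesis HS : forall y, (sigma2 d P y < +oo)%E /\
             (sigma2 d P y * (nx d P y * kappa%:E)^-1 <= (S y)%:E)%E.

(** Twice [sigma2], and the numerator in [nx]. *)
Let A y := (\int[P y]_u \int[P y]_v (d u v ^+ 2)%:E)%E.

Let inner_ge0 y u : (0 <= \int[P y]_v (d u v ^+ 2)%:E)%E.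
Proof. by apply: integral_ge0 => v _; rewrite lee_fin sqr_ge0. Qed.

Let A_ge0 y : (0 <= A y)%E.
Proof. exact: integral_ge0. Qed.

Let A_lty y : (A y < +oo)%E.
Proof.
have [+ _] := HS y; rewrite /sigma2 -/(A y).
move: (A_ge0 y); case: (A y) => [r||]; rewrite ?ltry//.
by rewrite gt0_muley// lte_fin invr_gt0.
Qed.

Let nx_ge0 y : (0 <= nx d P y)%E.
Proof.
apply: le_ereal_inf_tmp => _ [f [_ [B0 ->]]].
by apply: mule_ge0; [exact: A_ge0|rewrite inve_ge0 ltW].
Qed.

Lemma local_variance_bound_ge0 y : 0 <= S y.
Proof.
rewrite -lee_fin; have [_] := HS y; apply: le_trans.
apply: mule_ge0; first by apply: mule_ge0; [rewrite lee_fin invr_ge0|exact: A_ge0].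
by rewrite inve_ge0; apply: mule_ge0; [exact: nx_ge0|rewrite lee_fin ltW].
Qed.

(** Finiteness of [sigma2] yields a point [x0] whose squared distance is integrable; [f x0] and the
    distance to [x0] then control [f]. *)
Lemma lip_Lfun2_kernel K f y : lip d K f -> f \in Lfun (P y) 2%:E.
Proof.
move=> fK; have mf := lip_measurable dP dB fK.
have [x0 dx0] : exists x0, (\int[P y]_v (d x0 v ^+ 2)%:E < +oo)%E.
  (* Otherwise [A y] would be the integral of the constant [+oo] under a probability. *)
  apply: contrapT => /forallNP h; have := A_lty y; rewrite ltNge => /negP; apply.
  rewrite /A (_ : (fun u => _) = cst +oo%E); last first.
    by apply/funext => u; apply/eqP; rewrite -leye_eq leNgt; apply/negP/h.
  by rewrite integral_cst//= probability_setT mule1.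
apply: sqr_integrable_Lfun2 => //.
have md : measurable_fun setT (d x0) := lip_measurable dP dB (lip_metric dP x0).
apply: (@le_lt_trans _ _ (\int[P y]_v ((2 * f x0 ^+ 2)%:E + (2 * K ^+ 2)%:E * (d x0 v ^+ 2)%:E))%E).
  apply: ge0_le_integral_nonmeasurable => v; first by rewrite lee_fin sqr_ge0.
  rewrite -EFinM -EFinD lee_fin -mulrA -exprMn.
  have := fK x0 v; move: (K * d x0 v) => t ht.
  have : (f x0 - f v) ^+ 2 <= t ^+ 2.
    by rewrite -(real_normK (num_real (_ - _))) lerXn2r// nnegrE// (le_trans _ ht).
  (* With $a$ for [f x0] and $b$ for [f v]: $2a^2+2(a-b)^2-b^2=(b-2a)^2$. *)
  by have := sqr_ge0 (f v - 2 * f x0); rewrite !expr2; nra.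
rewrite ge0_integralD//=.
- rewrite integral_cst//= probability_setT mule1.
  rewrite ge0_integralZl//=.
  + apply: lte_add_pinfty; first by rewrite ltry.
    apply: lte_mul_pinfty; [|by []|exact: dx0].
    by rewrite lee_fin mulr_ge0 ?sqr_ge0.
  + exact/measurable_EFinP/measurable_funX.
  + by move=> v _; rewrite lee_fin sqr_ge0.
  + by rewrite lee_fin mulr_ge0 ?sqr_ge0.
- by move=> v _; rewrite lee_fin mulr_ge0 ?sqr_ge0.
- by move=> v _; apply: mule_ge0; [rewrite lee_fin mulr_ge0 ?sqr_ge0|rewrite lee_fin sqr_ge0].
- by apply: measurable_funeM; exact/measurable_EFinP/measurable_funX.
Qed.

(** If [v] is the variance, the denominator of [f] in [nx] is [2 * v], so [nx] is at most
    [A y / (2 * v)] and the left side of [HS] is at least [v / kappa]. *)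
Let lip1_variance f y : lip d 1 f -> ('V_(P y)[f] <= (kappa * S y)%:E)%E.
Proof.
move=> f1; have mf := lip_measurable dP dB f1.
have if_ := lip_integrable dP dB (PF y) f1.
have L2 := lip_Lfun2_kernel y f1.
set m := Pf f y.
have mE := markov_opK y f1; rewrite -/m in mE.
pose g z := f z - m.
have g1 : lip d 1 g by move=> u v; rewrite /g opprB addrA subrK.
have mg := lip_measurable dP dB g1.
have ig := lip_integrable dP dB (PF y) g1.
have L2g := lip_Lfun2_kernel y g1.
have ig2 : (P y).-integrable setT (fun z => (g z ^+ 2)%:E) := Lfun2_integrable_sqr L2g.
have g0 : (\int[P y]_z (g z)%:E = 0)%E.
  under eq_integral do rewrite EFinB.
  rewrite integralB_EFin//; last exact: finite_measure_integrable_cst.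
  by rewrite -mE integral_cst//= probability_setT mule1 subee.
have V0 := integrable_fin_num measurableT ig2.
pose v := fine (\int[P y]_z (g z ^+ 2)%:E).
have vE : (\int[P y]_z (g z ^+ 2)%:E = v%:E)%E by rewrite /v fineK.
have -> : 'V_(P y)[f] = v%:E.
  have -> : ('V_(P y)[f] = 'E_(P y)[fun z => (g z ^+ 2)%R])%E.
    rewrite /variance unlock; congr expectation; apply/funext => z.
    by rewrite [@expectation]unlock expr2.
  by rewrite unlock.
have v0 : 0 <= v by rewrite -lee_fin -vE integral_ge0// => z _; rewrite lee_fin sqr_ge0.
(* Centring at the mean kills the cross term, and each variable contributes [v]. *)
have BE : (\int[P y]_u \int[P y]_z (`|f u - f z| ^+ 2)%:E = (2 * v)%:E)%E.
  rewrite (_ : (fun u => _) = fun u => ((g u ^+ 2)%:E + v%:E)%E); last first.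
    apply/funext => u.
    transitivity (\int[P y]_z (((g u ^+ 2)%:E + (- (2 * g u))%:E * (g z)%:E) + (g z ^+ 2)%:E))%E.
      apply: eq_integral => z _; rewrite -EFinM -!EFinD real_normK ?num_real//.
      by congr EFin; rewrite /g; ring.
    have i1 : (P y).-integrable setT (fun z => (- (2 * g u))%:E * (g z)%:E)%E.
      exact: integrableZl.
    have i2 : (P y).-integrable setT (EFin \o (cst (g u ^+ 2))).
      exact: finite_measure_integrable_cst.
    rewrite integralD//; last exact: integrableD.
    rewrite integralD// integralZl// g0 mule0 adde0 vE.
    by rewrite integral_cst//= probability_setT mule1.
  rewrite integralD//; last exact: finite_measure_integrable_cst.
  by rewrite vE integral_cst//= probability_setT mule1 -EFinD; congr EFin; ring.
have S0 := local_variance_bound_ge0 y.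
(* [nx] ranges over functions with positive denominator only, so [v = 0] is settled apart. *)
rewrite lee_fin; have [->|v_neq0] := eqVneq v 0; first by rewrite mulr_ge0// ltW.
have {v0 v_neq0}v0 : 0 < v by rewrite lt_neqAle eq_sym v_neq0.
(* This makes [A y] positive, so that the bound on [nx] can be inverted. *)
have BA : ((2 * v)%:E <= A y)%E.
  rewrite -BE; apply: ge0_le_integral_nonmeasurable => u.
    by apply: integral_ge0 => z _; rewrite lee_fin sqr_ge0.
  apply: ge0_le_integral_nonmeasurable => z; first by rewrite lee_fin sqr_ge0.
  by rewrite lee_fin lerXn2r// ?nnegrE ?(metric_ge0 dP)// -[d u z]mul1r.
have [a aE] : exists a, A y = a%:E.
  by exists (fine (A y)); rewrite fineK// ge0_fin_numE.
have nle : (nx d P y <= (a / (2 * v))%:E)%E.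
  apply: ereal_inf_lbound; exists f; split; first by move=> u z; have := f1 u z; rewrite mul1r.
  split; first by rewrite BE lte_fin mulr_gt0.
  by rewrite BE -/(A y) aE inver gt_eqF ?mulr_gt0// EFinM.
rewrite aE lee_fin in BA.
have a0 : 0 < a by apply: lt_le_trans BA; rewrite mulr_gt0.
have [_] := HS y; rewrite /sigma2 -/(A y) aE => HSy.
have : ((2^-1)%:E * a%:E * ((a / (2 * v))%:E * kappa%:E)^-1 <= (S y)%:E)%E.
  apply: le_trans HSy; apply: lee_wpmul2l; first by rewrite lee_fin mulr_ge0// ltW.
  rewrite lee_pV2 ?inE/=.
  - by apply: lee_wpmul2r => //; rewrite lee_fin ltW.
  - by apply: mule_ge0; rewrite lee_fin ltW// divr_gt0// mulr_gt0.
  - by apply: mule_ge0; [exact: nx_ge0|rewrite lee_fin ltW].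
rewrite -!EFinM inver gt_eqF; last by rewrite mulr_gt0// divr_gt0// mulr_gt0.
rewrite -EFinM lee_fin => h.
have -> : v = kappa * (2^-1 * a * (a / (2 * v) * kappa)^-1).
  by field; rewrite !gt_eqF.
by rewrite ler_pM2l.
Qed.

Lemma lip_variance K f y : 0 <= K -> lip d K f ->
  ('V_(P y)[f] <= (K ^+ 2 * (kappa * S y))%:E)%E.
Proof.
move=> + fK; rewrite le_eqVlt => /predU1P[K0|K0].
  have -> : f = cst (f y).
    apply/funext => t; apply/eqP; rewrite -subr_eq0 -normr_le0 (le_trans (fK _ _))//.
    by rewrite -K0 mul0r.
  by rewrite variance_cst -K0 expr0n mul0r.
pose g x := K^-1 * f x.
have g1 : lip d 1 g by have := lipZ K^-1 fK; rewrite gtr0_norm ?invr_gt0// mulVf// gt_eqF.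
have -> : f = (K \o* g)%R.
  by apply/funext => x /=; rewrite /g mulrAC mulVf ?mul1r// gt_eqF.
rewrite varianceZ ?(lip_Lfun2_kernel y g1)// [leRHS]EFinM lee_wpmul2l ?lee_fin ?sqr_ge0//.
exact: lip1_variance.
Qed.

End local_variance.
End markov_operator.

(** * Transitions of the chain *)

Section chain.
Context {dX} {X : measurableType dX} {R : realType} (d : X -> X -> R).
Hypothesis dP : polish d.
Hypothesis dB : borel_of d.
Variable P : X -> probability X R.
Hypothesis PM : kernel_measurable P.
Hypothesis PF : forall y, finite_first_moment d (P y).
Context {dO} {Omega : measurableType dO} (Pr : probability Omega R).
Variables (Xs : nat -> Omega -> X) (x : X).
Hypothesis MC : markov_chain Pr Xs P x.
Local Notation Pf := (markov_op P).

Lemma chain_measurable k : measurable_fun setT (Xs k).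
Proof. by case: MC. Qed.
Hint Resolve chain_measurable : core.

Let mXs k A : measurable A -> measurable (Xs k @^-1` A).
Proof. by move=> mA; rewrite -[X in measurable X]setTI; exact: chain_measurable. Qed.

(** The path law is applied with [A] at time [i], [B] at time [k.+1] and the whole space at all
    other times. *)
Lemma chain_pair_law i k A B : (i <= k)%N -> measurable A -> measurable B ->
  Pr (Xs i @^-1` A `&` Xs k.+1 @^-1` B) = (\int[Pr]_(w in Xs i @^-1` A) P (Xs k w) B)%E.
Proof.
move=> ik mA mB; have [_ _ H] := MC.
pose F j := if j == k.+1 then B else if j == i then A else setT.
have mF j : measurable (F j) by rewrite /F; case: ifP => // _; case: ifP.
have FB : F k.+1 = B by rewrite /F eqxx.
have HH := H k F mF; rewrite FB in HH.
have past : \bigcap_(j in `I_k.+1) (Xs j @^-1` F j) = Xs i @^-1` A.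
  apply/seteqP; split => w /=.
    by move=> /(_ i ik); rewrite /F eqxx ltn_eqF.
  move=> Aw j /= jk; rewrite /F ltn_eqF//.
  by case: eqP => [->|].
rewrite past in HH; rewrite -HH; congr (Pr _); rewrite -past; apply/seteqP; split => w /=.
  move=> [h1 h2] j /=; rewrite ltnS leq_eqVlt => /predU1P[->|]; last exact: h1.
  by rewrite /F eqxx.
move=> h; split; first by move=> j /= jk; apply: h => /=; rewrite ltnS ltnW.
by have := h k.+1 (ltnSn _); rewrite /F eqxx.
Qed.

(** Conditioning on any time [i <= k], not just on [k], is what later makes innovations uncorrelated
    with every earlier term. *)
Lemma chain_integral_in i k A (g : X -> \bar R) : (i <= k)%N -> measurable A ->
  (forall y, 0 <= g y)%E -> measurable_fun setT g ->
  (\int[Pr]_(w in Xs i @^-1` A) g (Xs k.+1 w) =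
   \int[Pr]_(w in Xs i @^-1` A) \int[P (Xs k w)]_y g y)%E.
Proof.
move=> ik mA g0 mg; set D := Xs i @^-1` A; have mD : measurable D by exact: mXs.
(* Cutting both kernels off outside of [D] reduces the integrals over [D] to
   integrals over the whole space. *)
pose K1 w : {measure set X -> \bar R} :=
  if w \in D then (\d_(Xs k.+1 w) : {measure set X -> \bar R}) else (mzero : {measure set X -> \bar R}).
pose K2 w : {measure set X -> \bar R} :=
  if w \in D then (P (Xs k w) : {measure set X -> \bar R}) else (mzero : {measure set X -> \bar R}).
have K1E B : K1 ^~ B = (fun w => (\d_(Xs k.+1 w) B : \bar R)) \_ D.
  by apply/funext => w; rewrite /K1 patchE; case: ifP.
have K2E B : K2 ^~ B = (fun w => P (Xs k w) B) \_ D.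
  by apply/funext => w; rewrite /K2 patchE; case: ifP.
have mPX B : measurable B -> measurable_fun setT (fun w => P (Xs k w) B).
  by move=> mB; apply: (measurableT_comp (PM mB)).
have mK1 B : measurable B -> measurable_fun setT (K1 ^~ B).
  move=> mB; rewrite K1E; apply/measurable_restrict => //; rewrite setTI.
  apply: measurable_funTS; exact: (measurableT_comp (measurable_fun_dirac mB)).
have mK2 B : measurable B -> measurable_fun setT (K2 ^~ B).
  move=> mB; rewrite K2E; apply/measurable_restrict => //; rewrite setTI.
  by apply: measurable_funTS; exact: mPX.
have := ge0_integral_kernel_eq (mu1 := Pr) (mu2 := Pr) mK1 mK2 _ g0 mg.
move=> h; rewrite integral_mkcond [RHS]integral_mkcond.
transitivity (\int[Pr]_w \int[K1 w]_y g y)%E.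
  apply: eq_integral => w _; rewrite patchE /K1; case: ifP => _.
    by rewrite integral_dirac// diracT mul1e.
  by rewrite integral_measure_zero.
rewrite h; first by apply: eq_integral => w _; rewrite patchE /K2;
  case: ifP => // _; rewrite integral_measure_zero.
move=> B mB.
rewrite [LHS](_ : _ = \int[Pr]_w ((fun w => (\d_(Xs k.+1 w) B : \bar R)) \_ D) w)%E; last first.
  by apply: eq_integral => w _; rewrite -K1E.
rewrite [RHS](_ : _ = \int[Pr]_w ((fun w => P (Xs k w) B) \_ D) w)%E; last first.
  by apply: eq_integral => w _; rewrite -K2E.
rewrite -!integral_mkcond -chain_pair_law//.
transitivity (\int[Pr]_(w in D) (\1_(Xs k.+1 @^-1` B) w)%:E)%E.
  apply: eq_integral => w _; rewrite /= diracE indicE.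
  suff -> : (w \in Xs k.+1 @^-1` B) = (Xs k.+1 w \in B) by [].
  by apply/idP/idP; rewrite !inE.
rewrite (integral_indic _ mD); last exact: mXs.
by congr (Pr _); exact: setIC.
Qed.

Lemma chain_integral k (g : X -> \bar R) :
  (forall y, 0 <= g y)%E -> measurable_fun setT g ->
  (\int[Pr]_w g (Xs k.+1 w) = \int[Pr]_w \int[P (Xs k w)]_y g y)%E.
Proof.
move=> g0 mg; have := @chain_integral_in k k setT g (leqnn _) measurableT g0 mg.
by rewrite preimage_setT.
Qed.

Lemma chain_integral0 (g : X -> \bar R) :
  (forall y, 0 <= g y)%E -> measurable_fun setT g ->
  (\int[Pr]_w g (Xs 0%N w) = g x)%E.
Proof.
move=> g0 mg.
have law0 A : measurable A -> (\d_x A : \bar R) = Pr (Xs 0%N @^-1` A).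
  by move=> mA; case: MC => _ /(_ A mA) -> _.
rewrite (ge0_law_integral (chain_measurable 0) law0 g0 mg).
by rewrite integral_dirac// diracT mul1e.
Qed.

(** By [chain_integral_in], [g (Xs k.+1 w)] and [Pf g (Xs k w)] have equal integrals over all events
    of [Xs i], so [ge0_integral_comp_mul] applies. *)
Lemma chain_integral_mul i k K L h g : (i <= k)%N -> lip d K h -> lip d L g ->
  (forall y, 0 <= h y) -> (forall y, 0 <= g y) ->
  (\int[Pr]_w (h (Xs i w) * g (Xs k.+1 w))%:E =
   \int[Pr]_w (h (Xs i w) * Pf g (Xs k w))%:E)%E.
Proof.
move=> ik hK gL h0 g0; have mh := lip_measurable dP dB hK.
have mg := lip_measurable dP dB gL.
have mgE : measurable_fun setT (EFin \o g) by exact/measurable_EFinP.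
have mI : measurable_fun setT (fun y => \int[P y]_z (g z)%:E)%E.
  by apply: measurable_fun_integral_kernel.
have mPf : measurable_fun setT (Pf g).
  rewrite -measurable_EFinP (_ : _ \o _ = fun y => \int[P y]_z (g z)%:E)%E//.
  by apply/funext => y /=; rewrite (markov_opK dP dB PF y gL).
under eq_integral do rewrite EFinM.
under [RHS]eq_integral do rewrite EFinM.
apply: (@ge0_integral_comp_mul _ _ _ _ _ Pr (Xs i) (g \o Xs k.+1) (Pf g \o Xs k)
  _ _ _ _ _ _ (EFin \o h)) => //=.
- exact: measurableT_comp.
- by move=> w; exact: markov_op_ge0.
- exact: measurableT_comp.
- move=> A mA; rewrite (chain_integral_in (g := EFin \o g))//.
  by apply: eq_integral => w _; rewrite /= -(markov_opK dP dB PF _ gL).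
- exact/measurable_EFinP.
Qed.

End chain.

(** * Innovations and the variance of sums along the chain *)

Section chain_variance.
Context {dX} {X : measurableType dX} {R : realType} (d : X -> X -> R).
Hypothesis dP : polish d.
Hypothesis dB : borel_of d.
Variables (P : X -> probability X R) (kappa : R).
Hypothesis PM : kernel_measurable P.
Hypothesis PF : forall y, finite_first_moment d (P y).
Hypothesis W1P : forall y z, (W1 d (P y) (P z) <= ((1 - kappa) * d y z)%:E)%E.
Variables (S : X -> R) (C : R).
Hypothesis kappa0 : 0 < kappa.
Hypothesis HS : forall y, (sigma2 d P y < +oo)%E /\
             (sigma2 d P y * (nx d P y * kappa%:E)^-1 <= (S y)%:E)%E.
Hypothesis SC : lip d C S.
Context {dO} {Omega : measurableType dO} (Pr : probability Omega R).
Variables (Xs : nat -> Omega -> X) (x : X).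
Hypothesis MC : markov_chain Pr Xs P x.
Local Notation Pf := (markov_op P).

Let S0 y : 0 <= S y := local_variance_bound_ge0 kappa0 HS y.
Let mX k : measurable_fun setT (Xs k) := chain_measurable MC k.
Let PrT : Pr setT \is a fin_num := fin_num_measure Pr _ measurableT.
Let mlip K f (fK : lip d K f) : measurable_fun setT f := lip_measurable dP dB fK.

Let mEX (f : X -> R) k : measurable_fun setT f -> measurable_fun setT (fun w => (f (Xs k w))%:E).
Proof. by move=> mf; apply/measurable_EFinP; exact: (measurableT_comp mf). Qed.

Lemma kernel_sqr_le K f y : 0 <= K -> lip d K f ->
  (\int[P y]_z (f z ^+ 2)%:E <= (K ^+ 2 * (kappa * S y) + Pf f y ^+ 2)%:E)%E.
Proof.
move=> K0 fK; have L2 := lip_Lfun2_kernel dP dB HS y fK.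
have := lip_variance dP dB PF kappa0 HS y K0 fK.
rewrite varianceE// [@expectation]unlock -(markov_opK dP dB PF y fK).
by rewrite leeBlDr// -EFin_expe -EFinD.
Qed.

(** Integrates [kernel_sqr_le] over the law of [Xs k]. It serves both to carry square integrability
    from [k] to [k.+1] and to bound innovations. *)
Lemma chain_sqr_le k K f : 0 <= K -> lip d K f ->
  (\int[Pr]_w (f (Xs k.+1 w) ^+ 2)%:E <=
   (K ^+ 2 * kappa)%:E * \int[Pr]_w (S (Xs k w))%:E + \int[Pr]_w (Pf f (Xs k w) ^+ 2)%:E)%E.
Proof.
move=> K0 fK; have mf := mlip fK.
have Pfl := markov_op_lip dP dB PF W1P K0 fK.
rewrite (chain_integral PM MC k (g := fun y => (f y ^+ 2)%:E)); last 2 first.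
- by move=> y; rewrite lee_fin sqr_ge0.
- exact/measurable_EFinP/measurable_funX.
rewrite -ge0_integralZl//.
rewrite -ge0_integralD//.
- apply: ge0_le_integral_nonmeasurable => w.
    by apply: integral_ge0 => z _; rewrite lee_fin sqr_ge0.
  by rewrite -EFinM -EFinD -mulrA; exact: kernel_sqr_le.
- by move=> w _; rewrite mule_ge0// lee_fin// mulr_ge0 ?sqr_ge0// ltW.
- by apply: measurable_funeM; exact: mEX (mlip SC).
- by move=> w _; rewrite lee_fin sqr_ge0.
- by apply: mEX (fun y => Pf f y ^+ 2) _ _; exact: measurable_funX (mlip Pfl).
- exact: mEX (mlip SC).
- by move=> w _; rewrite lee_fin.
- by rewrite lee_fin mulr_ge0 ?sqr_ge0// ltW.
Qed.

(** Induction on time: the bound of [chain_sqr_le] at [k.+1] involves only [S] and [Pf f] at time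
    [k], both Lipschitz, hence the quantification over all [K] and [f]. *)
Lemma chain_Lfun2 k K f : lip d K f -> f \o Xs k \in Lfun Pr 2%:E.
Proof.
elim: k K f => [|k ih] K f fK; apply: sqr_integrable_Lfun2;
  try exact: measurableT_comp (mlip fK) _.
  rewrite (chain_integral0 MC (g := fun y => (f y ^+ 2)%:E)) ?ltry//.
    by move=> y; rewrite lee_fin sqr_ge0.
  exact/measurable_EFinP/measurable_funX/(mlip fK).
have fK' : lip d `|K| f by apply: lipS fK => //; exact: ler_norm.
apply: le_lt_trans (chain_sqr_le k (normr_ge0 K) fK') _.
have iS : Pr.-integrable setT (EFin \o (S \o Xs k)).
  by apply/Lfun1_integrable; apply: (Lfun_subset12 PrT); exact: ih SC.
have iPf : Pr.-integrable setT (EFin \o (fun w => Pf f (Xs k w) ^+ 2)).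
  by apply: Lfun2_integrable_sqr; exact: (ih _ _ (markov_op_lip dP dB PF W1P (normr_ge0 K) fK')).
have := integrable_fin_num measurableT iS; have := integrable_fin_num measurableT iPf.
rewrite /= => f1 f2; rewrite ltey_eq; apply/orP; left.
by rewrite fin_numD f1 fin_numM.
Qed.

Let L1 f k K : lip d K f -> f \o Xs k \in Lfun Pr 1.
Proof. by move=> fK; apply: (Lfun_subset12 PrT); exact: chain_Lfun2 fK. Qed.

Lemma lip_markov_op K f : lip d K f -> lip d (`|K| * (1 - kappa)) (Pf f).
Proof.
move=> fK; apply: (markov_op_lip dP dB PF W1P) => //.
by apply: lipS fK => //; exact: ler_norm.
Qed.

(** [chain_integral_mul] extends by bilinearity to positive and negative parts, first of [g], then
    of [h]; these parts stay Lipschitz, and square integrability makes the products integrable. *)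
Lemma chain_expectation_mul i k K L h g : (i <= k)%N -> lip d K h -> lip d L g ->
  ('E_Pr[(h \o Xs i) * (g \o Xs k.+1)] = 'E_Pr[(h \o Xs i) * (Pf g \o Xs k)])%E.
Proof.
move=> ik.
have step1 K' h' L' g' : lip d K' h' -> (forall y, 0 <= h' y) -> lip d L' g' ->
  ('E_Pr[(h' \o Xs i) * (g' \o Xs k.+1)] = 'E_Pr[(h' \o Xs i) * (Pf g' \o Xs k)])%E.
  move=> hK h0 gL.
  have gp := lip_funrpos gL; have gn := lip_funrneg gL.
  have gE : g' = g'^\+ \- g'^\- by exact: (esym (funrposBneg _)).
  have Lm j f K'' : lip d K'' f -> (h' \o Xs i) \* (f \o Xs j) \in Lfun Pr 1.
    by move=> fK; apply: Lfun2_mul_Lfun1; [exact: chain_Lfun2 hK|exact: chain_Lfun2 fK].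
  have e1 : (h' \o Xs i) * (g' \o Xs k.+1) = ((h' \o Xs i) \* (g'^\+ \o Xs k.+1)) \-
      ((h' \o Xs i) \* (g'^\- \o Xs k.+1)).
    apply/funext => w; rewrite {1}gE.
    by rewrite [LHS]/= [RHS]/= -mulrBr.
  have e2 : (h' \o Xs i) * (Pf g' \o Xs k) = ((h' \o Xs i) \* (Pf (g'^\+) \o Xs k)) \-
      ((h' \o Xs i) \* (Pf (g'^\-) \o Xs k)).
    apply/funext => w; rewrite [RHS]/= -mulrBr -(markov_opB dP dB PF _ gp gn).
    by rewrite -gE.
  rewrite e1 e2.
  rewrite !expectationB ?(Lm _ _ _ gp) ?(Lm _ _ _ gn)
    ?(Lm _ _ _ (lip_markov_op gp)) ?(Lm _ _ _ (lip_markov_op gn))//.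
  rewrite unlock; congr (_ - _)%E.
    apply: (chain_integral_mul dP dB PM PF MC ik hK gp h0) => y; exact: funrpos_ge0.
  apply: (chain_integral_mul dP dB PM PF MC ik hK gn h0) => y; exact: funrneg_ge0.
move=> hK gL; have hp := lip_funrpos hK; have hn := lip_funrneg hK.
have hE : h = h^\+ \- h^\- by exact: (esym (funrposBneg _)).
have splitE f j K' : lip d K' f -> ('E_Pr[(h \o Xs i) * (f \o Xs j)] =
    'E_Pr[((h^\+)%R \o Xs i) * (f \o Xs j)] - 'E_Pr[((h^\-)%R \o Xs i) * (f \o Xs j)])%E.
  move=> fK; rewrite -expectationB.
  - congr expectation; apply/funext => w; rewrite {1}hE.
    by rewrite [LHS]/= [RHS]/= mulrBl.
  - by apply: Lfun2_mul_Lfun1; [exact: chain_Lfun2 hp|exact: chain_Lfun2 fK].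
  - by apply: Lfun2_mul_Lfun1; [exact: chain_Lfun2 hn|exact: chain_Lfun2 fK].
rewrite (splitE _ _ _ gL) (splitE _ _ _ (lip_markov_op gL)).
by congr (_ - _)%E; [apply: step1 hp _ gL => y; exact: funrpos_ge0|
  apply: step1 hn _ gL => y; exact: funrneg_ge0].
Qed.

Lemma chain_expectation k L g : lip d L g ->
  ('E_Pr[g \o Xs k.+1] = 'E_Pr[Pf g \o Xs k])%E.
Proof.
move=> gL; have := chain_expectation_mul (leqnn k) (lip_cst d 1) gL.
have mul1 (f : Omega -> R) : ((fun=> 1) \o Xs k) * f = f.
  by apply/funext => w; rewrite [LHS]/= mul1r.
by rewrite !mul1.
Qed.

(** A martingale increment: the part of [g] at time [k.+1] that [Xs k] does not predict. *)
Definition innovation k (g : X -> R) : Omega -> R := (g \o Xs k.+1) \- (Pf g \o Xs k).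

Lemma innovation_Lfun2 k L g : lip d L g -> innovation k g \in Lfun Pr 2%:E.
Proof.
move=> gL; have g2 := chain_Lfun2 k.+1 gL.
have p2 := chain_Lfun2 k (lip_markov_op gL).
by apply: rpredB; rewrite ?lee1n.
Qed.

(** Replacing [g \o Xs k.+1] by [Pf g \o Xs k] changes neither the mean nor the product moment with
    [h \o Xs i], so the two covariances cancel. *)
Lemma covariance_innovation i k K L h g : (i <= k)%N -> lip d K h -> lip d L g ->
  covariance Pr (h \o Xs i) (innovation k g) = 0%E.
Proof.
move=> ik hK gL; have Pl := lip_markov_op gL.
have h2 := chain_Lfun2 i hK; have g2 := chain_Lfun2 k.+1 gL.
have p2 := chain_Lfun2 k Pl.
rewrite covarianceBr// covarianceE ?(L1 _ hK) ?(L1 _ gL)//; last exact: Lfun2_mul_Lfun1.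
rewrite covarianceE ?(L1 _ hK) ?(L1 _ Pl)//; last exact: Lfun2_mul_Lfun1.
rewrite (chain_expectation_mul ik hK gL) (chain_expectation k gL) subee//.
rewrite fin_numB fin_numM ?expectation_fin_num ?(L1 _ hK) ?(L1 _ Pl)//.
exact: Lfun2_mul_Lfun1.
Qed.

(** Orthogonality to [Pf g \o Xs k] makes this a difference of two variances. The means coincide, so
    only second moments remain, and [chain_sqr_le] compares them. *)
Lemma variance_innovation k K g : 0 <= K -> lip d K g ->
  ('V_Pr[innovation k g] <= (K ^+ 2 * kappa)%:E * \int[Pr]_w (S (Xs k w))%:E)%E.
Proof.
move=> K0 gK; have Pl := lip_markov_op gK.
have g2 := chain_Lfun2 k.+1 gK; have p2 := chain_Lfun2 k Pl.
have gp1 : (g \o Xs k.+1) * (Pf g \o Xs k) \in Lfun Pr 1 by exact: Lfun2_mul_Lfun1.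
have cov0 : covariance Pr (innovation k g) (Pf g \o Xs k) = 0%E.
  by rewrite covarianceC (covariance_innovation (leqnn k) Pl gK).
have V : ('V_Pr[g \o Xs k.+1] = 'V_Pr[innovation k g] + 'V_Pr[Pf g \o Xs k])%E.
  have {1}-> : g \o Xs k.+1 = innovation k g \+ (Pf g \o Xs k).
    by apply/funext => w /=; rewrite /innovation /= subrK.
  by rewrite varianceD// ?(innovation_Lfun2 k gK)// cov0 mule0 adde0.
have fp := variance_fin_num p2.
have -> : ('V_Pr[innovation k g] = 'V_Pr[g \o Xs k.+1] - 'V_Pr[Pf g \o Xs k])%E.
  by rewrite V addeK.
rewrite !varianceE// (chain_expectation k gK).
have fe : ('E_Pr[Pf g \o Xs k] \is a fin_num)%E by rewrite expectation_fin_num// (L1 _ Pl).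
have fe2 : ('E_Pr[(Pf g \o Xs k) ^+ 2] \is a fin_num)%E.
  by apply: expectation_fin_num; exact: Lfun2_mul_Lfun1.
rewrite leeBlDr ?fin_numB ?fe2 ?fin_numX// addeA leeD2r//.
by rewrite unlock; exact: chain_sqr_le.
Qed.

(** [b k] bounds the Lipschitz constant of [u k] itself, [a k] that of [u k] once it has absorbed
    the later terms; the recursion keeps this true at each absorption. The last function has
    absorbed nothing yet or is the result of an absorption, so it is only asked to be
    [a m]-Lipschitz. *)
Lemma variance_chain_sum m (u : nat -> X -> R) (a b : nat -> R) :
  (forall k, 0 <= a k) ->
  (forall k, (k < m)%N -> lip d (b k) (u k)) -> lip d (a m) (u m) ->
  (forall k, (k < m)%N -> b k + (1 - kappa) * a k.+1 <= a k) ->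
  ('V_Pr[fun w => (\sum_(k < m.+1) u k (Xs k w))%R] <=
   \sum_(j < m) (a j.+1 ^+ 2 * kappa)%:E * \int[Pr]_w (S (Xs j w))%:E)%E.
Proof.
move=> a0; elim: m u => [|m ih] u ub ua ab.
  (* At time 0 the chain sits at [x], so the variance is 0, like the empty sum. *)
  rewrite big_ord0 (_ : (fun w => _) = u 0%N \o Xs 0%N); last first.
    by apply/funext => w; rewrite big_ord1.
  rewrite varianceE ?(chain_Lfun2 0 ua)//.
  have intg (g : X -> R) : measurable_fun setT g -> ('E_Pr[g \o Xs 0%N] = (g x)%:E)%E.
    move=> mg; rewrite unlock.
    have mgE : measurable_fun setT (EFin \o g) by exact/measurable_EFinP.
    have law0 A : measurable A -> (\d_x A : \bar R)%E = Pr (Xs 0%N @^-1` A).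
      by move=> mA; case: MC => _ /(_ A mA) -> _.
    by rewrite (law_integral (mX 0%N) law0 mgE) integral_dirac// diracT mul1e.
  rewrite intg; last exact: mlip ua.
  rewrite (_ : (u 0%N \o Xs 0%N) ^+ 2 = (fun y => u 0%N y ^+ 2) \o Xs 0%N)//.
  rewrite intg; last exact: measurable_funX (mlip ua).
  by rewrite -EFin_expe subee.
(* The new last function absorbs the predictable part of the term peeled off. *)
pose v k := if k == m then u m \+ Pf (u m.+1) else u k.
have bm := ub m (ltnSn m).
have va : lip d (a m) (v m).
  rewrite /v eqxx; have := lipD bm (markov_op_lip dP dB PF W1P (a0 _) ua).
  by apply: lipS => //; rewrite mulrC; exact: ab.
have vb k : (k < m)%N -> lip d (b k) (v k).
  by move=> km; rewrite /v ltn_eqF//; apply: ub; exact: ltnW.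
have -> : (fun w => \sum_(k < m.+2) u k (Xs k w)) =
    (fun w => \sum_(k < m.+1) v k (Xs k w)) \+ innovation m (u m.+1).
  apply/funext => w /=; rewrite big_ord_recr/= big_ord_recr/= [in RHS]big_ord_recr/=.
  rewrite /innovation /= {2}/v eqxx /= -!addrA; congr (_ + _).
    by apply: eq_bigr => k _; rewrite /v ltn_eqF.
  by congr (_ + _); rewrite addrC subrK.
have sumE : (fun w => \sum_(k < m.+1) v k (Xs k w)) = \sum_(k < m.+1) (v k \o Xs k).
  by apply/funext => w; rewrite fct_sumE.
have vl (k : 'I_m.+1) : exists K, lip d K (v k).
  have := ltn_ord k; rewrite ltnS leq_eqVlt => /predU1P[->|km]; first by exists (a m).
  by exists (b k); exact: vb.
(* Additivity of the covariance requires square integrability, so both claims go together through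
   the sum. *)
have [s2 cov0] : (fun w => \sum_(k < m.+1) v k (Xs k w)) \in Lfun Pr 2%:E /\
    covariance Pr (fun w => (\sum_(k < m.+1) v k (Xs k w))%R) (innovation m (u m.+1)) = 0%E.
  rewrite sumE; elim/big_ind : _ => [|f g [f2 f0] [g2 g0]|k _].
  - by split; [exact: Lfun_cst|exact: covariance_cst_l].
  - split; first by apply: rpredD; rewrite ?lee1n.
    by rewrite covarianceDl ?f0 ?g0 ?adde0// (innovation_Lfun2 m ua).
  - have [K vK] := vl k; split; first exact: chain_Lfun2 vK.
    by apply: covariance_innovation vK ua; rewrite -ltnS.
rewrite varianceD// ?(innovation_Lfun2 m ua)// cov0 mule0 adde0 big_ord_recr/=.
apply: leeD; first by apply: ih => // k km; apply: ab; exact: ltnW.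
exact: variance_innovation.
Qed.

End chain_variance.

(** * Distance of the mean at time k to the invariant mean *)

Section chain_mean.
Context {dX} {X : measurableType dX} {R : realType} (d : X -> X -> R).
Hypothesis dP : polish d.
Hypothesis dB : borel_of d.
Variables (P : X -> probability X R) (kappa : R) (pi : probability X R).
Hypothesis PM : kernel_measurable P.
Hypothesis PF : forall y, finite_first_moment d (P y).
Hypothesis W1P : forall y z, (W1 d (P y) (P z) <= ((1 - kappa) * d y z)%:E)%E.
Hypothesis pi_inv : is_invariant P pi.
Context {dO} {Omega : measurableType dO} (Pr : probability Omega R).
Variables (Xs : nat -> Omega -> X) (x : X).
Hypothesis MC : markov_chain Pr Xs P x.
Local Notation Pf := (markov_op P).

(** By [pi_inv], the mixtures under [pi] of the Dirac masses and of the [P y] agree on measurable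
    sets. *)
Lemma invariant_integral (g : X -> \bar R) :
  (forall y, 0 <= g y)%E -> measurable_fun setT g ->
  (\int[pi]_y g y = \int[pi]_y \int[P y]_z g z)%E.
Proof.
move=> g0 mg.
have mdirac (A : set X) : measurable A -> measurable_fun setT (fun y : X => \d_y A : \bar R).
  by move=> mA; exact: measurable_fun_dirac.
have mPA (A : set X) : measurable A -> measurable_fun setT (fun y : X => P y A).
  by move=> mA; exact: PM.
have := @ge0_integral_kernel_eq _ _ _ _ _ _ _ pi pi (fun y => \d_y) P mdirac mPA.
move=> h; rewrite -h//.
  by apply: eq_integral => y _; rewrite integral_dirac// diracT mul1e.
move=> A mA; rewrite -pi_inv//.
transitivity (\int[pi]_y (\1_A y)%:E)%E.
  by apply: eq_integral => y _; rewrite /= diracE indicE.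
by rewrite integral_indic// setIT.
Qed.

(** Each step trades [g] for [Pf g], which multiplies the Lipschitz constant by [1 - kappa] and
    preserves the mean under [pi]. At time 0, integrate [g x <= g y + K * d x y] over [y]. *)
Lemma chain_integral_le k K g : kappa <= 1 -> 0 <= K -> lip d K g ->
  (forall y, 0 <= g y) ->
  (\int[Pr]_w (g (Xs k w))%:E <=
   \int[pi]_y (g y)%:E + (K * (1 - kappa) ^+ k)%:E * eccentricity d pi x)%E.
Proof.
move=> k1; elim: k K g => [|k ih] K g K0 gK g0.
  have mg := lip_measurable dP dB gK.
  have mgE : measurable_fun setT (EFin \o g) by exact/measurable_EFinP.
  have md := lip_measurable dP dB (lip_metric dP x).
  have mdE : measurable_fun setT (fun y => (d x y)%:E) by exact/measurable_EFinP.
  rewrite (chain_integral0 MC (g := EFin \o g))// expr0 mulr1 /eccentricity.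
  rewrite -ge0_integralZl//; last by move=> y _; rewrite lee_fin (metric_ge0 dP).
  rewrite -ge0_integralD//; last 3 first.
  - by move=> y _; rewrite lee_fin.
  - by move=> y _; rewrite mule_ge0// lee_fin (metric_ge0 dP).
  - exact: measurable_funeM.
  rewrite (_ : (EFin \o g) x = \int[pi]_y (cst (g x)%:E y))%E; last first.
    by rewrite integral_cst//= probability_setT mule1.
  apply: ge0_le_integral_nonmeasurable => y; first by rewrite lee_fin.
  rewrite /= -EFinM -EFinD lee_fin; have := gK x y; have := ler_norm (g x - g y); lra.
have mg := lip_measurable dP dB gK.
have mgE : measurable_fun setT (EFin \o g) by exact/measurable_EFinP.
have gE0 y : (0 <= (EFin \o g) y)%E by rewrite lee_fin.
rewrite (chain_integral PM MC k gE0 mgE) (invariant_integral gE0 mgE).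
have PfE y : (\int[P y]_z (g z)%:E = (Pf g y)%:E)%E by rewrite (markov_opK dP dB PF y gK).
under eq_integral do rewrite PfE.
under [X in (_ <= X + _)%E]eq_integral do rewrite PfE.
rewrite exprS mulrA; apply: ih.
- by rewrite mulr_ge0// subr_ge0.
- exact (markov_op_lip dP dB PF W1P K0 gK).
- by move=> y; exact: markov_op_ge0.
Qed.

End chain_mean.

(** * Geometric sums of the weights *)

Section geometric_weights.
Context {R : realType}.
Variables (kappa : R).
Hypotheses (kappa0 : 0 < kappa) (kappa1 : kappa <= 1).
Local Notation q := (1 - kappa).

Let q0 : 0 <= q. Proof. by rewrite subr_ge0. Qed.
Let q1 : q <= 1. Proof. by rewrite gerBl ltW. Qed.

Lemma sum_geometric_le n : \sum_(i < n) q ^+ i <= kappa^-1.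
Proof.
have : kappa * \sum_(i < n) q ^+ i = 1 - q ^+ n.
  elim: n => [|n ih]; first by rewrite big_ord0 mulr0 expr0 subrr.
  by rewrite big_ord_recr mulrDr ih exprS /=; ring.
move=> h; rewrite -(ler_pM2l kappa0) h mulfV ?gt_eqF// gerBl exprn_ge0//.
Qed.

Lemma sum_rev_geometric_le n : \sum_(j < n) q ^+ (n - j) <= kappa^-1.
Proof.
apply: le_trans (sum_geometric_le n).
(* Reversal makes the exponent [j.+1]; the extra factor [q] is at most 1. *)
rewrite (reindex_inj rev_ord_inj)/=; apply: ler_sum => j _.
by rewrite subKn// exprS ler_piMl// exprn_ge0.
Qed.

(* Truncated subtraction: the weights are [1] for [j >= T0]. *)
Lemma sum_weight_le T0 T : \sum_(j < T0 + T) (q ^+ (T0 - j)) ^+ 2 <=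
  T%:R + (if T0 == 0%N then 0 else kappa^-1).
Proof.
rewrite big_split_ord/= addrC; apply: lerD.
  rewrite (eq_bigr (fun=> 1)) ?sumr_const ?card_ord// => i _.
  by rewrite subnDA subnn sub0n expr0 expr1n.
case: eqP => [->|_]; first by rewrite big_ord0.
apply: le_trans (sum_rev_geometric_le T0); apply: ler_sum => j _.
by rewrite expr2 ler_piMl ?exprn_ge0// exprn_ile1.
Qed.

(** The terms [j >= T0] sum to [q ^+ T0] times a geometric sum. For [j < T0] the exponent is
    [2 * (T0 - j) + j = T0 + (T0 - j)], so this block has the same bound, whence the factor 2; it is
    empty when [T0 = 0]. *)
Lemma sum_weight_geometric_le T0 T :
  \sum_(j < T0 + T) (q ^+ (T0 - j)) ^+ 2 * q ^+ j <=
  (if T0 == 0%N then 1 else 2) * q ^+ T0 / kappa.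
Proof.
rewrite big_split_ord/=.
have -> : \sum_(i < T) (q ^+ (T0 - (T0 + i))) ^+ 2 * q ^+ (T0 + i) =
    q ^+ T0 * \sum_(i < T) q ^+ i.
  rewrite mulr_sumr; apply: eq_bigr => i _.
  by rewrite subnDA subnn sub0n expr0 expr1n mul1r exprD.
have -> : \sum_(i < T0) (q ^+ (T0 - i)) ^+ 2 * q ^+ i =
    q ^+ T0 * \sum_(j < T0) q ^+ (T0 - j).
  rewrite mulr_sumr; apply: eq_bigr => i _.
  rewrite expr2 -mulrA -exprD subnK 1?ltnW// mulrC//.
have qT : 0 <= q ^+ T0 by exact: exprn_ge0.
have h1 := ler_wpM2l qT (sum_geometric_le T).
have h2 := ler_wpM2l qT (sum_rev_geometric_le T0).
case: eqP => [T00|_]; last by lra.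
by move: h1; rewrite T00 big_ord0; lra.
Qed.

End geometric_weights.

(** * The empirical mean and the final bound *)

Lemma pihatE {R : realType} {dO} {Omega : measurableType dO} {dX} {X : measurableType dX}
    (Xs : nat -> Omega -> X) (T T0 : nat) (f : X -> R) :
  pihat Xs T T0 f = (fun w => \sum_(k < (T0 + T).+1)
    (if (T0 < k)%N then (fun y => T%:R^-1 * f y) else fun=> 0) (Xs k w)).
Proof.
apply/funext => w.
rewrite -(big_mkord xpredT (fun k => (if (T0 < k)%N then (fun y => T%:R^-1 * f y)
  else fun=> 0) (Xs k w))).
rewrite (@big_cat_nat _ _ _ T0.+1)//=; last by rewrite ltnS leq_addr.
rewrite big_nat big1 ?add0r; last by move=> k /andP[_ kT]; rewrite ltnNge -ltnS kT.
rewrite /pihat mulr_sumr addn1; apply: eq_big_nat => k /andP[Tk _].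
by rewrite Tk.
Qed.

Theorem theorem3 (R : realType)
  (dX : measure_display) (X : measurableType dX) (d : X -> X -> R)
  (P : X -> probability X R) (kappa : R) (pi : probability X R)
  (S : X -> R) (C : R) (T T0 : nat) (f : X -> R) (x : X)
  (dO : measure_display) (Omega : measurableType dO)
  (Pr : probability Omega R) (Xs : nat -> Omega -> X) :
  polish d -> borel_of d ->
  kernel_measurable P ->
  (forall y, finite_first_moment d (P y)) ->
  0 < kappa ->
  (forall y z, (W1 d (P y) (P z) <= ((1 - kappa) * d y z)%:E)%E) ->
  is_invariant P pi ->
  (1 <= T)%N ->
  (lipnorm d S <= C%:E)%E ->
  (forall y, (sigma2 d P y < +oo)%E /\
             (sigma2 d P y * (nx d P y * kappa%:E)^-1 <= (S y)%:E)%E) ->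
  (lipnorm d f < +oo)%E ->
  markov_chain Pr Xs P x ->
  ('V_Pr[pihat Xs T T0 f] <=
    if T0 == 0%N then
      lipnorm d f * lipnorm d f * ((kappa * T%:R)^-1)%:E *
      (\int[pi]_y (S y)%:E + (C / (kappa * T%:R))%:E * eccentricity d pi x)
    else
      lipnorm d f * lipnorm d f * ((kappa * T%:R)^-1)%:E *
      ((1 + (kappa * T%:R)^-1)%:E * \int[pi]_y (S y)%:E +
       (2 * C * (1 - kappa) ^+ T0 / (kappa * T%:R))%:E * eccentricity d pi x))%E.

Proof.
move=> dP dB PM PF kappa0 W1P pi_inv T1 SlC HS fy MC.
have SC := lipnorm_le_lip dP SlC.
have C0 : 0 <= C by rewrite -lee_fin (le_trans (lipnorm_ge0 d S)).
have S0 y : 0 <= S y := local_variance_bound_ge0 kappa0 HS y.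
have [L fL] : exists L, lipnorm d f = L%:E.
  by exists (fine (lipnorm d f)); rewrite fineK// ge0_fin_numE// lipnorm_ge0.
have L0 : 0 <= L by rewrite -lee_fin -fL lipnorm_ge0.
have fl : lip d L f by apply: lipnorm_le_lip => //; rewrite fL.
set M := (\int[pi]_y (S y)%:E)%E; set E := eccentricity d pi x.
have M0 : (0 <= M)%E by apply: integral_ge0 => y _; rewrite lee_fin.
have E0 : (0 <= E)%E by apply: integral_ge0 => y _; rewrite lee_fin (metric_ge0 dP).
(* If [L = 0], [f] is constant and both sides vanish, even if [M] or [E] is infinite. Otherwise
   there are two distinct points, which gives [kappa <= 1]. *)
rewrite fL; have [L00|Lneq0] := eqVneq L 0.
  have fc : f = cst (f x).
    by apply/funext => y; apply/eqP; rewrite -subr_eq0 -normr_le0 (le_trans (fl _ _))// L00 mul0r.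
  have -> : pihat Xs T T0 f = cst (T%:R^-1 * \sum_(T0.+1 <= k < T0 + T + 1) f x).
    by apply/funext => w; rewrite /pihat fc.
  by rewrite variance_cst L00 !mul0e; case: ifP.
have kappa1 : kappa <= 1.
  apply: contrapT => k1; move/eqP: Lneq0; apply.
  have f0 : (lipnorm d f <= 0)%E.
    apply: ge_ereal_sup => _ [->//|[y [z [yz ->]]]].
    by case: k1; exact: (kappa_le1 dP W1P yz).
  by apply/eqP; rewrite eq_le L0 andbT -lee_fin -fL.
have T0lt : 0 < T%:R :> R by rewrite ltr0n.
pose q := 1 - kappa; have q0 : 0 <= q by rewrite subr_ge0.
have q1 : q <= 1 by rewrite gerBl ltW.
(* The fixed point of $t = L/T + (1-\kappa)t$. *)
pose c := L / (kappa * T%:R).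
have c0 : 0 <= c by rewrite divr_ge0// mulr_ge0// ltW.
have cE : L / T%:R = kappa * c by rewrite /c; field; rewrite !gt_eqF.
(* [a] is the solution of [a k = b k + q * a k.+1] that is constant for [k > T0];
   the subtraction is truncated. *)
pose a k := c * q ^+ (T0.+1 - k).
pose b k := if (T0 < k)%N then L / T%:R else 0.
have ul k : lip d (b k) (if (T0 < k)%N then (fun y => T%:R^-1 * f y) else fun=> 0).
  rewrite /b; case: ifP => _; last exact: lip_cst.
  have := lipZ T%:R^-1 fl; rewrite ger0_norm ?invr_ge0 ?ler0n//.
  by apply: lipS => //; rewrite mulrC.
have ba k : b k + (1 - kappa) * a k.+1 <= a k.
  rewrite /b /a subSS -/q; case: ltnP => [Tk|kT].
    have -> : (T0.+1 - k = 0)%N by apply/eqP; rewrite subn_eq0.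
    have -> : (T0 - k = 0)%N by apply/eqP; rewrite subn_eq0 ltnW.
    by rewrite expr0 cE /q; lra.
  by rewrite add0r subSn// exprS mulrCA.
have bTa : b (T0 + T)%N <= a (T0 + T)%N.
  have := ba (T0 + T)%N; apply: le_trans; rewrite lerDl mulr_ge0// mulr_ge0// exprn_ge0//.
have a0 k : 0 <= a k by rewrite mulr_ge0// exprn_ge0.
(* Zero functions up to time [T0] turn the mean into a sum over all times, as in
   [variance_chain_sum] with [m = T0 + T]. *)
rewrite pihatE.
apply: le_trans (variance_chain_sum dP dB PM PF W1P kappa0 HS SC MC a0 (fun k _ => ul k)
  (lipS dP bTa (ul _)) (fun k _ => ba k)) _.
pose w j := (q ^+ (T0 - j)) ^+ 2.
have w0 j : 0 <= w j by rewrite sqr_ge0.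
pose c2 := c ^+ 2 * kappa; have c20 : 0 <= c2 by rewrite mulr_ge0 ?sqr_ge0// ltW.
have wq0 j : 0 <= w j * q ^+ j by rewrite mulr_ge0// exprn_ge0.
have cC0 : 0 <= c2 * C by rewrite mulr_ge0.
(* Bounds each mean of [S] by [chain_integral_le]. [M] and [E] are only known to be nonnegative
   extended reals, so distributing over sums relies on nonnegative coefficients. *)
have step : (\sum_(j < T0 + T) (a j.+1 ^+ 2 * kappa)%:E * \int[Pr]_w0 (S (Xs j w0))%:E <=
    (c2 * \sum_(j < T0 + T) w j)%:E * M +
    (c2 * C * \sum_(j < T0 + T) w j * q ^+ j)%:E * E)%E.
  rewrite [X in (X%:E * M)%E]mulr_sumr [X in (X%:E * E)%E]mulr_sumr -!sumEFin.
  rewrite !ge0_sume_distrl; last 2 first.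
  - by move=> j _; rewrite lee_fin mulr_ge0.
  - by move=> j _; rewrite lee_fin mulr_ge0.
  rewrite -big_split/=; apply: lee_sum => j _.
  have -> : a j.+1 ^+ 2 * kappa = c2 * w j by rewrite /a subSS /c2 /w exprMn mulrAC.
  have := chain_integral_le dP dB PM PF W1P pi_inv MC j kappa1 C0 SC S0.
  rewrite -/M -/E -/q => h.
  have cw0 : 0 <= c2 * w j by rewrite mulr_ge0.
  apply: le_trans (lee_wpmul2l _ h) _; first by rewrite lee_fin.
  rewrite ge0_muleDr//; last by rewrite mule_ge0// lee_fin mulr_ge0// exprn_ge0.
  apply: leeD => //; rewrite muleA -EFinM lee_wpmul2r// lee_fin.
  by rewrite mulrACA.
clearbody M E; apply: le_trans step _.
have h1 := ler_wpM2l c20 (sum_weight_le kappa0 kappa1 T0 T).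
have h2 := ler_wpM2l cC0 (sum_weight_geometric_le kappa0 kappa1 T0 T).
have kn0 : kappa != 0 by rewrite gt_eqF.
have Tn0 : T%:R != 0 :> R by rewrite gt_eqF.
(* The constants match because [c2 * T] is $L^2/(\kappa T)$ and [c2 / kappa] is this quantity
   divided by $\kappa T$. *)
case: eqP h1 h2 => [T00|_] h1 h2.
- rewrite ge0_muleDr//; last by rewrite mule_ge0// lee_fin divr_ge0// mulr_ge0// ltW.
  rewrite -!EFinM muleA -EFinM; apply: leeD; apply: lee_wpmul2r => //; rewrite lee_fin.
    apply: (le_trans h1); rewrite le_eqVlt; apply/orP; left; apply/eqP.
    by rewrite /c2 /c; field; rewrite Tn0.
  apply: (le_trans h2); rewrite le_eqVlt; apply/orP; left; apply/eqP.
  by rewrite T00 expr0 /c2 /c; field; rewrite Tn0.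
- rewrite ge0_muleDr//; last 2 first.
    by rewrite mule_ge0// lee_fin addr_ge0// invr_ge0 mulr_ge0// ltW.
    by rewrite mule_ge0// lee_fin divr_ge0 ?mulr_ge0 ?exprn_ge0// ltW.
  rewrite -!EFinM !muleA -!EFinM; apply: leeD; apply: lee_wpmul2r => //; rewrite lee_fin.
    apply: (le_trans h1); rewrite le_eqVlt; apply/orP; left; apply/eqP.
    by rewrite /c2 /c; field; rewrite Tn0.
  apply: (le_trans h2); rewrite le_eqVlt; apply/orP; left; apply/eqP.
  by rewrite -/q /c2 /c; field; rewrite Tn0.
Qed.
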